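(* Let $N\ge 2$, let $T_N$ be the homogeneous tree in which every vertex has degree $N$, and fix a root $o$. Let $m>1$ and $(p,q)\in G_2=\{(p,q)\in\mathbb R^2: q\ge m\}$. Then for every $\epsilon>0$ there exists a weight $\mu$ on $T_N$ such that $$W_o(n)\asymp n^{m}(\ln n)^{m-1+\epsilon}\quad\text{for } n\ge 2,$$ and the inequality $\Delta_m u+u^p|\nabla u|^q\le 0$ on $T_N$ admits a nontrivial positive solution.
   Context: A weight on a graph $(V,E)$ is a symmetric function $\mu:V\times V\to[0,\infty)$ with $\mu_{xy}=\mu_{yx}>0$ if and only if $x\sim y$ (adjacent); $\mu(x)=\sum_{y\sim x}\mu_{xy}$. For $m>1$, $\Delta_m u(x)=\frac{1}{\mu(x)}\sum_{y\sim x}\mu_{xy}|u(y)-u(x)|^{m-2}(u(y)-u(x))$ and $|\nabla u(x)|=\big(\sum_{y\sim x}\frac{\mu_{xy}}{2\mu(x)}(u(y)-u(x))^2\big)^{1/2}$. $d$ is the graph distance, $B(o,n)=\{x: d(o,x)\le n\}$, $W_o(n)=\sum_{x\in B(o,n),\,y\in V,\,d(o,x)<d(o,y)}\mu_{xy}$. $f(n)\asymp g(n)$ for $n\ge2$ means there are constants $c,C>0$ with $c\,g(n)\le f(n)\le C\,g(n)$ for all $n\ge 2$. A nontrivial positive solution is a non-constant $u:V\to(0,\infty)$ with $\Delta_m u(x)+u(x)^p|\nabla u(x)|^q\le0$ for all $x\in V$. *)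

(* Defs.v *)
From HB Require Import structures.
From mathcomp Require Import all_boot all_order all_algebra.
From mathcomp Require Import all_classical all_reals all_analysis.
Set Implicit Arguments. Unset Strict Implicit. Unset Printing Implicit Defensive.
Import Order.TTheory GRing.Theory Num.Theory.
Local Open Scope classical_set_scope.
Local Open Scope ring_scope.

Section Graph.
Variables (R : realType) (V : choiceType) (adj : V -> V -> Prop).

Definition is_weight (mu : V -> V -> R) : Prop :=
  (forall x y, mu x y = mu y x) /\ (forall x y, 0 <= mu x y) /\
  (forall x y, 0 < mu x y <-> adj x y).

Definition muv (mu : V -> V -> R) (x : V) : R :=
  \sum_(y \in [set y | adj x y]) mu x y.

Definition mlap (mu : V -> V -> R) (m : R) (u : V -> R) (x : V) : R :=
  (muv mu x)^-1 * \sum_(y \in [set y | adj x y])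
      (mu x y * (`|u y - u x| `^ (m - 2) * (u y - u x))).

Definition gradn (mu : V -> V -> R) (u : V -> R) (x : V) : R :=
  Num.sqrt (\sum_(y \in [set y | adj x y])
      (mu x y / (2 * muv mu x) * (u y - u x) ^+ 2)).

Inductive walk : V -> V -> nat -> Prop :=
| walk0 x : walk x x 0
| walkS x z y k : adj x z -> walk z y k -> walk x y k.+1.

Definition gdist (x y : V) : nat :=
  match pselect (exists k, walk x y k) with
  | left h => ex_minn (P := fun k => `[< walk x y k >])
                (let: ex_intro k hk := h in ex_intro _ k (asboolT hk))
  | right _ => 0%N
  end.

Definition ball (o : V) (n : nat) : set V := [set x | (gdist o x <= n)%N].

Definition Wo (mu : V -> V -> R) (o : V) (n : nat) : R :=
  \sum_(x \in ball o n) \sum_(y \in [set y | (gdist o x < gdist o y)%N]) mu x y.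

End Graph.

Definition asymp (R : realType) (f g : nat -> R) : Prop :=
  exists c C : R, 0 < c /\ 0 < C /\
    forall n : nat, (2 <= n)%N -> c * g n <= f n /\ f n <= C * g n.

(* Homogeneous tree T_N: vertices are words over {0..N-1} with no two
   consecutive equal letters (Cayley graph of the free product of N copies
   of Z/2); x ~ y iff one is the other extended by one letter.  Every vertex
   has degree N. *)
Definition tvalid (N : nat) : pred (seq nat) :=
  fun s => all (fun a => (a < N)%N) s && sorted (fun a b => a != b) s.

Definition TN (N : nat) := {s : seq nat | tvalid N s}.

Definition tadj (N : nat) (x y : TN N) : Prop :=
  (exists a, val y = rcons (val x) a) \/ (exists a, val x = rcons (val y) a).

(* Main.v *)
Require Import Defs.
From HB Require Import structures.
From mathcomp Require Import all_boot all_order all_algebra.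
From mathcomp Require Import all_classical all_reals all_analysis.
From mathcomp Require Import zify ring lra.
Import Order.TTheory GRing.Theory Num.Theory.
Local Open Scope classical_set_scope.
Local Open Scope ring_scope.

(** Everything is radial about [o]. Let [a_k] be the total weight between the
    spheres of radii [k] and [k+1], let [u = g_k] on the sphere of radius [k],
    and put [d_k = g_k - g_(k+1)] and [F_k = a_k d_k^(m-1)], the m-flux. On the
    sphere of radius [k] the inequality reads
    [F_k - F_(k-1) >= (a_(k-1) + a_k) g_k^p |grad u|^q], and as [q >= m] and
    [d <= 1] the right-hand side is [O(F_(k-1) d_(k-1))]. With [d_k] summable,
    [g_k = 2 - S_k] and [F_k = 1 + C S_k], where [S_k] is the k-th partial sum
    of [d], do the job once [(C + 1) S_k <= 1]. The choice
    [d_k = c / ((k+2) ln(k+2)^(1+s))] with [s = eps / (m-1)] is summable and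
    yields [a_k] of order [k^(m-1) (ln k)^(m-1+eps)]. *)

(** * Reduced words in the free product of [N] copies of Z/2 *)

Section Words.
Set Implicit Arguments. Unset Strict Implicit.
Context {N : nat}.
Local Open Scope nat_scope.
Implicit Types (s w c : seq nat) (a b : nat).

(** Since [last N [::]] is [N], which differs from every letter, the empty word needs no separate
    clause. *)
Lemma tvalid_rcons s a :
  tvalid N (rcons s a) = [&& tvalid N s, a < N & last N s != a].
Proof.
rewrite /tvalid all_rcons; case: s => [|b s] /=.
  by rewrite andbT; case: ltnP => //= aN; rewrite gtn_eqF.
by rewrite rcons_path; case: (a < N); case: (b < N); case: (all _ s);
  case: (path _ b s); case: (last b s != a).
Qed.

Lemma tvalid_rev s : tvalid N (rev s) = tvalid N s.
Proof.
rewrite /tvalid all_rev rev_sorted; congr (_ && _).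
by apply: eq_sorted => a b; rewrite eq_sym.
Qed.

(* Right multiplication by the generator [a] in the free product of [N] copies
   of Z/2; the default [N] of [last] is not a letter. *)
Definition flipw a s := if last N s == a then take (size s).-1 s else rcons s a.

Lemma flipw_last s a : flipw a (rcons s a) = s.
Proof. by rewrite /flipw last_rcons eqxx size_rcons -cats1 take_size_cat. Qed.

Lemma flipw_rcons s a : tvalid N (rcons s a) -> flipw a s = rcons s a.
Proof. by rewrite tvalid_rcons /flipw => /and3P[_ _ /negbTE->]. Qed.

Lemma tvalid_flipw s a : a < N -> tvalid N s -> tvalid N (flipw a s).
Proof.
move=> aN; rewrite /flipw; case: eqP => [|/eqP] la.
  case: (lastP s) la => [|s' b] //= _.
  by rewrite tvalid_rcons size_rcons -cats1 take_size_cat// => /and3P[].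
by rewrite tvalid_rcons aN la => ->.
Qed.

Lemma flipwK s a : a < N -> tvalid N s -> flipw a (flipw a s) = s.
Proof.
move=> aN sv; rewrite {2}/flipw; case: eqP => [|/eqP] la; last first.
  by rewrite flipw_last.
case: (lastP s) la sv => [/=|s' b].
  by move=> E; rewrite E ltnn in aN.
rewrite last_rcons => -> sv.
by rewrite size_rcons -[X in take _ X]cats1 take_size_cat// flipw_rcons.
Qed.

Lemma size_flipw s a : a < N ->
  size (flipw a s) = if last N s == a then (size s).-1 else (size s).+1.
Proof.
move=> aN; rewrite /flipw; case: eqP => // _; last by rewrite size_rcons.
by rewrite size_take; case: s => //= b s; rewrite ltnSn.
Qed.

Lemma last_lt s : tvalid N s -> 0 < size s -> last N s < N.
Proof.
case: (lastP s) => // s' b.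
by rewrite tvalid_rcons last_rcons => /and3P[].
Qed.

(* Left multiplication by the group element [c]. *)
Definition translw c s := foldl (fun t a => flipw a t) c s.

Lemma translw_rcons c s a : translw c (rcons s a) = flipw a (translw c s).
Proof. by rewrite /translw foldl_rcons. Qed.

Lemma tvalid_translw c s : tvalid N c -> tvalid N s -> tvalid N (translw c s).
Proof.
move=> cv; elim/last_ind: s => // s a IH.
rewrite tvalid_rcons => /and3P[sv aN _].
by rewrite translw_rcons tvalid_flipw// IH.
Qed.

(** Left and right multiplications commute, so left translations preserve adjacency and any root can
    be moved to the empty word. If [s] ends in [a], the two flips by [a] on the right-hand side
    cancel. *)
Lemma translw_flipw c s a : a < N -> tvalid N c -> tvalid N s ->
  translw c (flipw a s) = flipw a (translw c s).
Proof.
move=> aN cv sv; have [la|la] := eqVneq (last N s) a; last first.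
  by rewrite {1}/flipw (negbTE la) translw_rcons.
case: (lastP s) la sv => [/=|s' b].
  by move=> E; rewrite E ltnn in aN.
rewrite last_rcons => -> sv.
rewrite flipw_last translw_rcons flipwK//.
by move: sv; rewrite tvalid_rcons => /and3P[? _ _]; exact: tvalid_translw.
Qed.

(** Generators are their own inverses, so the reversed word is the group inverse. *)
Lemma translw_rev c : translw (rev c) c = [::].
Proof.
by elim: c => //= a c IH; rewrite rev_cons flipw_last.
Qed.

Lemma translwK c s : tvalid N c -> tvalid N s ->
  translw c (translw (rev c) s) = s.
Proof.
move=> cv; elim/last_ind: s => [_|s a IH sv].
  by rewrite -[X in translw X]revK translw_rev.
move: (sv); rewrite tvalid_rcons => /and3P[sv' aN _].
rewrite translw_rcons translw_flipw ?tvalid_translw ?tvalid_rev// IH//.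
exact: flipw_rcons.
Qed.

(** Lengths tell a deletion from an extension. Two deletions both name the last letter, and two
    extensions show their letters. This makes the [N] neighbours of a vertex distinct. *)
Lemma flipw_inj s a b : a < N -> b < N -> flipw a s = flipw b s -> a = b.
Proof.
move=> aN bN E; have := congr1 size E; rewrite !size_flipw//.
case: eqP => [e1|na]; case: eqP => [e2|nb]; [by rewrite -e1 -e2|lia|lia|move=> _].
move: E; rewrite /flipw; case: eqP => // _; case: eqP => // _.
exact: rcons_injr.
Qed.
End Words.

(** * Levels and spheres about an arbitrary root *)

Section Tree.
Set Implicit Arguments. Unset Strict Implicit.
Context {N : nat}.
Hypothesis N_gt1 : (1 < N)%N.
Local Open Scope nat_scope.
Implicit Types (x y z : TN N) (a b : 'I_N).

Definition flip a x : TN N :=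
  Sub (flipw (N := N) a (val x)) (tvalid_flipw (ltn_ord a) (valP x)).

Lemma flipK a : involutive (flip a).
Proof. by move=> x; apply: val_inj; rewrite /= flipwK//; exact: (valP x). Qed.

Lemma flip_inj x : injective (fun a => flip a x).
Proof.
move=> a b /(congr1 val)/= E; apply: val_inj => /=.
exact: (flipw_inj (s := val x) (ltn_ord a) (ltn_ord b)).
Qed.

Lemma tadjP x y : tadj x y <-> exists a, y = flip a x.
Proof.
split=> [[] [a E]|[a ->]].
- have := valP y; rewrite /= E => v.
  have aN : a < N by move: v; rewrite tvalid_rcons => /and3P[].
  by exists (Ordinal aN); apply: val_inj; rewrite E /= flipw_rcons.
- have := valP x; rewrite /= E => v.
  have aN : a < N by move: v; rewrite tvalid_rcons => /and3P[].
  by exists (Ordinal aN); apply: val_inj; rewrite /= E flipw_last.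
- rewrite /tadj /= /flipw; case: eqP => [la|_]; [right|by left; exists a].
  exists a; case: (lastP (val x)) la => [/= E|s b].
    by have := ltn_ord a; rewrite -E ltnn.
  by rewrite last_rcons => ->; rewrite size_rcons -[X in take _ X]cats1 take_size_cat.
Qed.

Lemma tadj_sym x y : tadj x y -> tadj y x.
Proof. by move=> /tadjP[a ->]; apply/tadjP; exists a; rewrite flipK. Qed.

Lemma nbhds_flip x : [set y | tadj x y] = [set` [seq flip a x | a <- enum 'I_N]].
Proof.
apply/seteqP; split=> y /=.
  by move=> /tadjP[a ->]; apply/mapP; exists a => //; rewrite mem_enum.
by move=> /mapP[a _ ->]; apply/tadjP; exists a.
Qed.

Variable o : TN N.

(** The reduced word of the group element [o^-1 x]; its length turns out to be the distance from [o]
    to [x]. *)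
Definition lvlw x := translw (N := N) (rev (val o)) (val x).
Definition lvl x := size (lvlw x).

Lemma tvalid_lvlw x : tvalid N (lvlw x).
Proof. by apply: tvalid_translw; rewrite ?tvalid_rev; exact: (valP _). Qed.

Lemma lvl_root : lvl o = 0.
Proof. by rewrite /lvl /lvlw translw_rev. Qed.

Lemma lvl_eq0 x : lvl x = 0 -> x = o.
Proof.
move=> /size0nil E; apply: val_inj.
rewrite -(translwK (valP o) (valP x)) -/(lvlw x) E.
by rewrite /translw.
Qed.

(** Translation commutes with [flip], so the step by the last letter of [lvlw x] leads towards [o]
    and all other steps lead away. *)
Lemma lvl_flip a x :
  lvl (flip a x) = if last N (lvlw x) == a then (lvl x).-1 else (lvl x).+1.
Proof.
rewrite /lvl /lvlw /= translw_flipw ?size_flipw ?tvalid_rev//; exact: (valP _).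
Qed.

Lemma lvl_flip_gt a x : (lvl x < lvl (flip a x)) = (last N (lvlw x) != a).
Proof. by rewrite lvl_flip; case: eqP => _ /=; lia. Qed.

Lemma lvl_parent x : 0 < lvl x ->
  exists a0, forall a, (last N (lvlw x) == a) = (a == a0).
Proof.
move=> x0; have h := last_lt (tvalid_lvlw x) x0.
by exists (Ordinal h) => a; rewrite -val_eqE /= eq_sym.
Qed.

Lemma lvl_root_last a x : lvl x = 0 -> (last N (lvlw x) == a) = false.
Proof. by move=> /size0nil ->/=; apply/negbTE; rewrite neq_ltn ltn_ord orbT. Qed.

Lemma walk_rcons x y z k :
  walk (@tadj N) x z k -> tadj z y -> walk (@tadj N) x y k.+1.
Proof.
elim=> {x z k} [x|x z w k xz _ IH] h; first exact: walkS h (walk0 _ _).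
exact: walkS xz (IH h).
Qed.

Lemma walk_lvl x : walk (@tadj N) o x (lvl x).
Proof.
have [n] := ubnP (lvl x); elim: n => // n IH in x *; rewrite ltnS => xn.
case: (posnP (lvl x)) => [/[dup] E /lvl_eq0 ->|x0].
  by rewrite lvl_root; exact: walk0.
have [a0 ha] := lvl_parent x0.
have E : lvl x = (lvl (flip a0 x)).+1 by rewrite lvl_flip ha eqxx prednK.
rewrite E; apply: (@walk_rcons _ _ (flip a0 x)); first by apply: IH; lia.
by apply/tadjP; exists a0; rewrite flipK.
Qed.

Lemma walk_lvl_le x y k : walk (@tadj N) x y k -> lvl y <= lvl x + k.
Proof.
elim=> {x y k} [x|x z y k /tadjP[a ->] _ IH]; first by rewrite addn0.
apply: leq_trans IH _; rewrite lvl_flip; case: ifP => _; lia.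
Qed.

(** Going from parent to parent gives a walk of length [lvl x], and no walk is shorter because a
    step raises the level by at most one. *)
Lemma gdist_lvl x : gdist (@tadj N) o x = lvl x.
Proof.
rewrite /gdist; case: pselect => [h|[]]; last by exists (lvl x); exact: walk_lvl.
case: ex_minnP => k /asboolP wk kmin; apply/eqP; rewrite eqn_leq.
rewrite kmin; last by apply/asboolP; exact: walk_lvl.
by have := walk_lvl_le wk; rewrite lvl_root.
Qed.

Definition sphere_size k := if k is j.+1 then N * N.-1 ^ j else 1.

Lemma sphere_size_gt0 k : 0 < sphere_size k.
Proof. by case: k => //= k; rewrite muln_gt0 expn_gt0; lia. Qed.

(** The product form treats the root, with [N] children, and the other vertices, with [N.-1],
    alike. *)
Lemma card_children x :
  sphere_size (lvl x) * #|[pred a | lvl x < lvl (flip a x)]| =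
  sphere_size (lvl x).+1.
Proof.
case: (posnP (lvl x)) => [x0|x0].
  rewrite x0 /= expn0 muln1 mul1n -[RHS]card_ord; apply: eq_card => a.
  by rewrite !inE -x0 lvl_flip_gt lvl_root_last.
have [a0 ha] := lvl_parent x0.
have -> : #|[pred a | lvl x < lvl (flip a x)]| = N.-1.
  rewrite -[in RHS](card_ord N) -(cardC1 a0); apply: eq_card => a.
  by rewrite !inE lvl_flip_gt ha.
by case: (lvl x) x0 => //= k _; rewrite -mulnA -expnSr.
Qed.

Fixpoint sphere k : seq (TN N) :=
  if k is j.+1 then
    [seq flip a x | x <- sphere j, a <- [seq a <- enum 'I_N | lvl x < lvl (flip a x)]]
  else [:: o].

Lemma mem_sphere k x : (x \in sphere k) = (lvl x == k).
Proof.
elim: k x => [|k IH] x /=.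
  by rewrite inE; apply/eqP/eqP => [->|/lvl_eq0//]; exact: lvl_root.
apply/allpairsPdep/eqP => [[y [a [+ + ->]]]|xk].
  rewrite IH mem_filter => /eqP yk /andP[+ _].
  by rewrite lvl_flip_gt lvl_flip yk => /negbTE->.
have x0 : 0 < lvl x by rewrite xk.
have [a0 ha] := lvl_parent x0.
have E : lvl (flip a0 x) = k by rewrite lvl_flip ha eqxx xk.
exists (flip a0 x), a0; split; rewrite ?IH ?flipK ?E//.
by rewrite mem_filter mem_enum flipK xk leqnn.
Qed.

(** A child determines the letter that led to it, namely the last letter of its [lvlw], and flipping
    by that letter recovers the parent. *)
Lemma sphere_uniq k : uniq (sphere k).
Proof.
elim: k => //= k IH; apply: allpairs_uniq_dep => //.
  by move=> x _; rewrite filter_uniq// enum_uniq.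
have H x a : lvl x < lvl (flip a x) -> last N (lvlw (flip a x)) == a.
  move=> h; have := lvl_flip a (flip a x); rewrite flipK; case: ifP => // _; lia.
move=> _ _ /allpairsPdep[x [a [_ + ->]]] /allpairsPdep[y [b [_ + ->]]] /=.
rewrite !mem_filter => /andP[/H xa _] /andP[/H yb _] E.
have ab : a = b by apply: val_inj => /=; rewrite -(eqP xa) -(eqP yb) E.
by rewrite -ab in E *; rewrite (inv_inj (flipK a) E).
Qed.

Lemma size_sphere k : size (sphere k) = sphere_size k.
Proof.
elim: k => // k IH; rewrite [sphere _]/= size_allpairs_dep sumnE big_map.
have H x : x \in sphere k ->
    size [seq a <- enum 'I_N | lvl x < lvl (flip a x)] = sphere_size k.+1 %/ sphere_size k.
  (* The division is exact: all vertices of a sphere have the same number of children. *)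
  rewrite mem_sphere => /eqP xk; rewrite -[in sphere_size k.+1]xk -card_children.
  rewrite xk mulKn ?sphere_size_gt0// enumT cardE /enum_mem.
  by congr size; apply: eq_filter => a; rewrite inE xk.
rewrite (eq_big_seq _ H) big_const_seq count_predT iter_addn_0 IH mulnC.
case: k {IH H} => [|k]; first by rewrite mul1n divn1.
by rewrite /= expnSr mulnA mulKn// -/(sphere_size k.+1) sphere_size_gt0.
Qed.

End Tree.

(** * Radial weights, and the operators applied to radial functions *)

Section RadialWeight.
Set Implicit Arguments. Unset Strict Implicit.
Context {R : realType} {N : nat}.
Hypothesis N_gt1 : (1 < N)%N.
Variables (o : TN N) (a : nat -> R).
Hypothesis a_gt0 : forall k, 0 < a k.
Implicit Types x y : TN N.
Local Notation lvl := (lvl o).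
Local Notation sphere_size := (@sphere_size N).

(* [a k] is the total weight of the edges between the spheres of radii [k] and
   [k.+1], spread uniformly. *)
Definition radw x y : R :=
  if `[< tadj x y >]
  then a (minn (lvl x) (lvl y)) / (sphere_size (minn (lvl x) (lvl y)).+1)%:R
  else 0.

Lemma radw_weight : is_weight (@tadj N) radw.
Proof.
have pos k : 0 < a k / (sphere_size k.+1)%:R.
  by rewrite divr_gt0// ltr0n sphere_size_gt0.
split=> [x y|]; last split=> x y; rewrite /radw.
- rewrite (minnC (lvl y)); congr (if _ then _ else _).
  by apply/asboolP/asboolP; exact: tadj_sym.
- by case: ifP => // _; exact: ltW.
- by case: asboolP => // h; split => //; rewrite ltxx.
Qed.

Lemma fsum_nbrs (f : TN N -> R) x :
  \sum_(y \in [set y | tadj x y]) f y = \sum_(b < N) f (flip b x).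
Proof.
rewrite nbhds_flip -fsbig_seq ?big_map ?big_enum//.
by rewrite (map_inj_uniq (@flip_inj N x)) enum_uniq.
Qed.

Definition inflow k := if k is j.+1 then a j else 0.

(** By symmetry each vertex of a sphere carries an equal share of the weight on either side of it.
    At the root [k.-1] is 0, but its coefficient [inflow 0] vanishes. *)
Lemma fsum_radw (h : nat -> R) x (k := lvl x) :
  \sum_(y \in [set y | tadj x y]) radw x y * h (lvl y) =
  (inflow k * h k.-1 + a k * h k.+1) / (sphere_size k)%:R.
Proof.
rewrite fsum_nbrs.
have E b : radw x (flip b x) = a (minn k (lvl (flip b x))) /
    (sphere_size (minn k (lvl (flip b x))).+1)%:R.
  by rewrite /radw asboolT//; apply/tadjP; exists b.
have sg j : (sphere_size j)%:R != 0 :> R.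
  by rewrite pnatr_eq0 -lt0n sphere_size_gt0.
case: (posnP k) => [k0|k0].
  have F b : radw x (flip b x) * h (lvl (flip b x)) = a 0%N / N%:R * h 1%N.
    by rewrite E lvl_flip lvl_root_last// -/k k0 /= min0n expn0 muln1.
  rewrite (eq_bigr _ (fun b _ => F b)) sumr_const card_ord -mulr_natl k0 /=.
  have N0 : N%:R != 0 :> R by rewrite pnatr_eq0; lia.
  by field.
have [b0 hb] := lvl_parent (o := o) k0.
(* Away from the root, the parent is split off and the other [N.-1] neighbours are children. *)
rewrite (bigD1 b0)//= E lvl_flip hb eqxx -/k.
rewrite (eq_bigr (fun=> a k / (sphere_size k.+1)%:R * h k.+1)); last first.
  move=> b nb; rewrite E lvl_flip hb (negbTE nb) -/k.
  by rewrite (minn_idPl (leqnSn k)).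
rewrite sumr_const cardC1 card_ord (minn_idPr (leq_pred k)).
have [j kj] : exists j, k = j.+1 by exists k.-1; rewrite prednK.
rewrite kj /= expnS mulnCA natrM -mulr_natl.
by field; apply/and3P; split; rewrite pnatr_eq0 -lt0n ?expn_gt0; lia.
Qed.

Lemma muv_radw x (k := lvl x) :
  muv (@tadj N) radw x = (inflow k + a k) / (sphere_size k)%:R.
Proof.
rewrite /muv -[inflow k]mulr1 -[a k]mulr1 -(fsum_radw (fun=> 1)).
by apply: eq_fsbigr => y _; rewrite mulr1.
Qed.

Lemma mlap_radw (m : R) (g : nat -> R) x (k := lvl x)
    (h := fun j => `|g j - g k| `^ (m - 2) * (g j - g k)) :
  mlap (@tadj N) radw m (fun y => g (lvl y)) x =
  (inflow k * h k.-1 + a k * h k.+1) / (inflow k + a k).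
Proof.
rewrite /mlap muv_radw (fsum_radw h) -/k invf_div mulrC mulrA; congr (_ * _).
by rewrite mulfVK// pnatr_eq0 -lt0n sphere_size_gt0.
Qed.

Lemma gradn_radw (g : nat -> R) x (k := lvl x) :
  gradn (@tadj N) radw (fun y => g (lvl y)) x =
  Num.sqrt ((inflow k * (g k.-1 - g k) ^+ 2 + a k * (g k.+1 - g k) ^+ 2) /
    (2 * (inflow k + a k))).
Proof.
rewrite /gradn muv_radw -/k.
set c := 2 * _.
rewrite (_ : \sum_(y \in _) _ =
    \sum_(y \in [set y | tadj x y]) radw x y * ((g (lvl y) - g k) ^+ 2 / c)); last first.
  by apply: eq_fsbigr => y _; rewrite mulrAC mulrA.
rewrite (fsum_radw (fun j => (g j - g k) ^+ 2 / c)) -/k; congr Num.sqrt.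
have s0 : (sphere_size k)%:R != 0 :> R.
  by rewrite pnatr_eq0 -lt0n sphere_size_gt0.
have c0 : inflow k + a k != 0.
  by apply: lt0r_neq0; rewrite ltr_wpDl// /inflow; case: (k) => // j; exact: ltW.
by rewrite /c; field; rewrite s0 c0.
Qed.

Lemma fsum_outflow x (k := lvl x) :
  \sum_(y \in [set y | (gdist (@tadj N) o x < gdist (@tadj N) o y)%N]) radw x y =
  a k / (sphere_size k)%:R.
Proof.
have D y : gdist (@tadj N) o y = lvl y by exact: gdist_lvl.
rewrite D -/k.
(* Both sums reduce to the children of [x]: farther non-neighbours have weight 0, and the indicator
   removes the parent. *)
transitivity (\sum_(y \in [set y | tadj x y]) radw x y * (k < lvl y)%N%:R).
  rewrite -(@fsbig_widen _ _ _ _ [set y | tadj x y /\ (k < lvl y)%N]); first last.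
  - move=> y [/=]; rewrite D => ky nxy; rewrite /radw; case: asboolP => // xy.
    by exfalso; apply: nxy.
  - by move=> y /= [_]; rewrite D.
  rewrite -(@fsbig_widen _ _ _ _ [set y | tadj x y /\ (k < lvl y)%N]
    [set y | tadj x y]); first last.
  - move=> y [/= xy nxy]; case: ltnP => [ky|_]; last by rewrite mulr0.
    by exfalso; apply: nxy.
  - by move=> y /= [].
  by apply: eq_fsbigr => y; rewrite inE /= => -[_ ->]; rewrite mulr1.
rewrite (fsum_radw (fun j => (k < j)%N%:R)) -/k ltnSn mulr1.
by rewrite ltnNge leq_pred mulr0 add0r.
Qed.

Lemma fsum_ball (f : nat -> R) n :
  \sum_(x \in Defs.ball (@tadj N) o n) f (lvl x) =
  \sum_(k < n.+1) (sphere_size k)%:R * f k.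
Proof.
have Sph k : [set x | lvl x = k] = [set` sphere o k].
  by apply/seteqP; split=> x /=; rewrite mem_sphere// => /eqP.
have fS k : finite_set [set x | lvl x = k] by rewrite Sph; exact: finite_seq.
have sumS k : \sum_(x \in [set x | lvl x = k]) f (lvl x) = (sphere_size k)%:R * f k.
  rewrite Sph -fsbig_seq ?sphere_uniq// (eq_big_seq (fun=> f k)).
    by rewrite big_const_seq count_predT size_sphere// iter_addr_0 mulr_natl.
  by move=> x; rewrite mem_sphere// => /eqP->.
have -> : Defs.ball (@tadj N) o n = [set x | lvl x <= n]%N.
  by apply/seteqP; split=> x; rewrite /Defs.ball /= gdist_lvl.
(* Finiteness is proved in the same induction, as it is needed to split the sum over the union of a
   ball and a sphere. *)
suff [] : finite_set [set x | lvl x <= n]%N /\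
  \sum_(x \in [set x | (lvl x <= n)%N]) f (lvl x) =
  \sum_(k < n.+1) (sphere_size k)%:R * f k by [].
elim: n => [|n [fn IH]].
  rewrite (_ : [set x | (lvl x <= 0)%N] = [set x | lvl x = 0%N]).
    by rewrite sumS big_ord1.
  by apply/seteqP; split=> x /=; rewrite leqn0 => /eqP.
have -> : [set x | (lvl x <= n.+1)%N] = [set x | (lvl x <= n)%N] `|` [set x | lvl x = n.+1].
  apply/seteqP; split=> x /=; first by rewrite leq_eqVlt ltnS => /orP[/eqP|]; [right|left].
  by case=> [/leqW//|->].
split; first by rewrite finite_setU.
rewrite fsbigU//; last by move=> x [/= + E]; rewrite E ltnn.
by rewrite sumS IH [RHS]big_ord_recr.
Qed.

Lemma Wo_radw n : Wo (@tadj N) radw o n = \sum_(k < n.+1) a k.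
Proof.
rewrite /Wo (eq_fsbigr (fun x => a (lvl x) / (sphere_size (lvl x))%:R)); last first.
  by move=> x _; exact: fsum_outflow.
rewrite (fsum_ball (fun k => a k / (sphere_size k)%:R)); apply: eq_bigr => k _.
by rewrite mulrC mulfVK// pnatr_eq0 -lt0n sphere_size_gt0.
Qed.
End RadialWeight.

(** * Real powers, the logarithmic sequence and its sums *)

Lemma powRDr1 (R : realType) (x y : R) : 0 < x -> x `^ (y + 1) = x `^ y * x.
Proof.
by move=> x0; rewrite powRD ?powRr1 ?ltW// lt0r_neq0// implybT.
Qed.

Section LogSequence.
Set Implicit Arguments. Unset Strict Implicit.
Context {R : realType}.
Implicit Types s b x y : R.

(** The shift by two keeps the logarithm positive from [k = 0] on. *)
Definition logn2 k : R := ln k.+2%:R.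
Local Notation L := logn2.

Lemma logn2_gt0 k : 0 < L k.
Proof. by rewrite ln_gt0// ltr1n. Qed.

(** Squaring the argument doubles the logarithm; this reduces the later comparisons of logarithms up
    to a factor 2 to integer inequalities. *)
Lemma le_ln_sqr (i j : nat) : (0 < i)%N -> (i <= j ^ 2)%N -> ln i%:R <= 2 * ln j%:R :> R.
Proof.
move=> i0 ij; have j0 : (0 < j)%N by move: ij i0; case: j => //; lia.
rewrite mulr_natl -lnXn ?ltr0n// -natrX ler_ln ?posrE ?ltr0n ?expn_gt0 ?j0//.
by rewrite ler_nat.
Qed.

Lemma le_logn2 i j : (i <= j)%N -> L i <= L j.
Proof. by move=> ij; rewrite ler_ln ?posrE ?ltr0n// ler_nat. Qed.

Lemma logn2_doubling k : L k.+1 <= 2 * L k.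
Proof. by apply: le_ln_sqr => //; nia. Qed.

(** The convex function [t^(-s)] lies above its tangent at [y]. After scaling to [t = x / y] this is
    [exp(- s ln t) >= 1 - s ln t >= 1 + s (1 - t)]. *)
Lemma powRN_tangent s x y : 0 < s -> 0 < x -> 0 < y ->
  y `^ (- s) + s * (y - x) * y `^ (- s - 1) <= x `^ (- s).
Proof.
move=> s0 x0 y0.
have xy : 0 < x / y by rewrite divr_gt0.
have -> : x `^ (- s) = (x / y) `^ (- s) * y `^ (- s).
  by rewrite -powRM ?ltW// divfK ?lt0r_neq0.
have -> : y `^ (- s - 1) = y `^ (- s) / y.
  by rewrite -[in RHS](subrK 1 (- s)) powRDr1// mulfK// lt0r_neq0.
rewrite (_ : _ + _ = (1 + s * (1 - x / y)) * y `^ (- s)); last first.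
  by field; exact: lt0r_neq0.
rewrite ler_pM2r ?powR_gt0// /powR (negbTE (lt0r_neq0 xy)).
apply: le_trans (expR_ge1Dx _); rewrite lerD2l mulNr -mulrN ler_pM2l//.
have : ln (1 + (x / y - 1)) <= x / y - 1 by apply: le_ln1Dx; lra.
by rewrite subrKC; lra.
Qed.

Definition logseq s k : R := (k.+2%:R * L k `^ (1 + s))^-1.
Local Notation e := logseq.

Lemma logseq_gt0 s k : 0 < e s k.
Proof. by rewrite invr_gt0 mulr_gt0 ?ltr0n// powR_gt0// logn2_gt0. Qed.

Lemma logseq_noninc s k : 0 < s -> e s k.+1 <= e s k.
Proof.
move=> s0; have s1 : 0 <= 1 + s by lra.
rewrite lef_pV2 ?posrE ?mulr_gt0 ?ltr0n ?powR_gt0 ?logn2_gt0//.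
rewrite ler_pM ?powR_ge0 ?ler_nat//.
by rewrite ge0_ler_powR ?nnegrE ?le_logn2// ltW ?logn2_gt0.
Qed.

Lemma logseq_doubling s k : 0 < s -> e s k <= 2 * 2 `^ (1 + s) * e s k.+1.
Proof.
move=> s0; have s1 : 0 <= 1 + s by lra.
rewrite -ler_pdivrMl ?mulr_gt0 ?powR_gt0// /e -invfM.
rewrite lef_pV2 ?posrE ?mulr_gt0 ?ltr0n ?powR_gt0 ?logn2_gt0//.
rewrite mulrACA ler_pM ?powR_ge0//.
  by rewrite -natrM ler_nat; lia.
have L0 j : 0 <= L j := ltW (logn2_gt0 j).
by rewrite -powRM// ge0_ler_powR ?nnegrE ?mulr_ge0// logn2_doubling.
Qed.

(** A discrete integral test: [- (ln t)^(-s) / s] is a primitive of [1 / (t (ln t)^(1+s))]. The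
    tangent inequality is combined with [L k.+1 - L k >= 1 / (k+3)]. *)
Lemma logseq_le_telescope s k : 0 < s ->
  s * e s k.+1 <= L k `^ (- s) - L k.+1 `^ (- s).
Proof.
move=> s0; have := powRN_tangent s0 (logn2_gt0 k) (logn2_gt0 k.+1).
suff : e s k.+1 <= (L k.+1 - L k) * L k.+1 `^ (- s - 1).
  by rewrite -(ler_pM2l s0) mulrA; lra.
rewrite /e invfM -powRN opprD addrC -[X in _ `^ X]/(- s - 1).
rewrite ler_pM2r ?powR_gt0 ?logn2_gt0//.
(* As [(k+2) / (k+3) = 1 - t], the logarithms differ by [- ln (1 - t)], which is at least [t]. *)
have := @le_ln1Dx R (- k.+3%:R^-1); set t := k.+3%:R^-1 => h.
have k3 : 0 < k.+3%:R :> R by rewrite ltr0n.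
have t1 : t < 1 by rewrite invf_lt1// ltr1n.
have : L k = L k.+1 + ln (1 - t).
  rewrite /L -lnM ?posrE ?subr_gt0//; congr ln.
  by rewrite mulrBr mulr1 divff ?lt0r_neq0// -[k.+3]addn1 natrD addrK.
have : ln (1 - t) <= - t by apply: h; lra.
lra.
Qed.

(** The telescoping bound starts at index 1, so the term [e s 0] is kept apart; the resulting bound
    is uniform in [n]. *)
Lemma sum_logseq_le s n : 0 < s ->
  \sum_(k < n) e s k <= e s 0 + s^-1 * L 0 `^ (- s).
Proof.
move=> s0.
have nn k : 0 <= s^-1 * L k `^ (- s) by rewrite mulr_ge0 ?powR_ge0 ?invr_ge0 ?ltW.
case: n => [|n]; first by rewrite big_ord0 addr_ge0// ltW ?logseq_gt0.
suff : \sum_(k < n.+1) e s k <= e s 0 + s^-1 * (L 0 `^ (- s) - L n `^ (- s)).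
  by move=> /le_trans; apply; rewrite mulrBr; have := nn n; lra.
elim: n => [|n IH]; first by rewrite big_ord1 subrr mulr0 addr0.
rewrite big_ord_recr /=.
have : e s n.+1 <= s^-1 * (L n `^ (- s) - L n.+1 `^ (- s)).
  by rewrite -ler_pdivrMl ?invr_gt0// invrK; exact: logseq_le_telescope.
by rewrite !mulrBr in IH *; lra.
Qed.

Lemma logseq_powR s c k (t := c * e s k) : 0 < c -> forall y,
  (t `^ y)^-1 = (c `^ y)^-1 * (k.+2%:R `^ y * L k `^ ((1 + s) * y)).
Proof.
move=> c0 y; have L0 := powR_gt0 (1 + s) (logn2_gt0 k).
rewrite /t powRM ?ltW ?logseq_gt0// invfM; congr (_ * _).
rewrite -powRN /e -powR_inv1 ?mulr_ge0 ?ltW// -powRrM mulN1r opprK.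
by rewrite powRM ?ltW// -powRrM.
Qed.

(** From below, only the indices [k >= n/2] are kept; from above, every term is replaced by one
    common bound. *)
Lemma asymp_sum_powR_ln m b : 1 < m -> 0 < b ->
  asymp (fun n => \sum_(k < n.+1) (k.+2%:R `^ (m - 1) * L k `^ b))
        (fun n => n%:R `^ m * ln n%:R `^ b).
Proof.
move=> m1 b0; pose z : R := 2^-1.
have z0 : 0 < z by rewrite invr_gt0.
have m10 : 0 <= m - 1 by lra.
exists (z `^ m * z `^ b), (2 `^ m * 2 `^ b).
split; first by rewrite mulr_gt0 ?powR_gt0.
split; first by rewrite mulr_gt0 ?powR_gt0.
have [z0' Lge0] := (ltW z0, fun k => ltW (logn2_gt0 k)).
move=> n n2; have n0 : 0 < n%:R :> R by rewrite ltr0n; lia.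
have ln0 : 0 <= ln n%:R :> R by rewrite ln_ge0// ler1n; lia.
(* Reads each bound as a number of terms [c n] times a term size, with [c = 1/2] below and [c = 2]
   above. *)
have scale c : 0 < c -> c `^ m * c `^ b * (n%:R `^ m * ln n%:R `^ b) =
    (c * n%:R) * ((c * n%:R) `^ (m - 1) * (c * ln n%:R) `^ b).
  move=> /ltW c0; have n0' := ltW n0.
  rewrite [RHS]mulrA mulr_powRB1 ?mulr_ge0//; last lra.
  by rewrite !powRM// mulrACA.
rewrite !scale//; split.
- have hn : (n./2 <= n.+1)%N by lia.
  rewrite -(big_mkord predT (fun k => k.+2%:R `^ (m - 1) * L k `^ b)).
  rewrite (big_cat_nat _ hn)//=.
  apply: (@le_trans _ _ (\sum_(n./2 <= k < n.+1) ((z * n%:R) `^ (m - 1) * (z * ln n%:R) `^ b))).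
    rewrite sumr_const_nat -[leRHS]mulr_natl ler_wpM2r ?mulr_ge0 ?powR_ge0//.
    rewrite /z mulrC ler_pdivrMr// -natrM ler_nat; lia.
  rewrite -[leLHS]add0r lerD ?sumr_ge0// => [k _|]; first by rewrite mulr_ge0 ?powR_ge0.
  apply: ler_sum_nat => k /andP[hk _].
  rewrite ler_pM ?powR_ge0// ge0_ler_powR ?nnegrE ?mulr_ge0 ?Lge0// ?(ltW b0)//.
    rewrite /z mulrC ler_pdivrMr// -natrM ler_nat; lia.
  (* For [k >= n/2] one has [n <= (k+2)^2], so [L k] is at least half of [ln n]. *)
  rewrite /z mulrC ler_pdivrMr// mulrC.
  by apply: le_ln_sqr; [lia|nia].
- apply: (@le_trans _ _ (\sum_(k < n.+1) ((2 * n%:R) `^ (m - 1) * (2 * ln n%:R) `^ b))).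
    rewrite ler_sum// => k _; have kn := ltn_ord k.
    rewrite ler_pM ?powR_ge0// ge0_ler_powR ?nnegrE ?mulr_ge0 ?Lge0// ?(ltW b0)//.
      by rewrite -natrM ler_nat; lia.
    (* Here [k + 2 <= n + 2 <= n^2], since [n >= 2]. *)
    by apply: le_ln_sqr => //; nia.
  rewrite sumr_const card_ord -[leLHS]mulr_natl ler_wpM2r ?mulr_ge0 ?powR_ge0//.
  by rewrite -natrM ler_nat; lia.
Qed.

End LogSequence.

(** * The radial supersolution for an abstract sequence of decrements *)

Section Supersolution.
Set Implicit Arguments. Unset Strict Implicit.
Context {R : realType}.
Variables (m p q r : R) (d : nat -> R).
Hypotheses (m_gt1 : 1 < m) (q_gem : m <= q) (r_ge1 : 1 <= r).
Hypotheses (d_gt0 : forall k, 0 < d k) (d_noninc : forall k, d k.+1 <= d k).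
Hypothesis d_doubling : forall k, d k `^ (m - 1) <= r * d k.+1 `^ (m - 1).
(** The first factor bounds [g k ^ p]; the second bounds [(a_(k-1) + a_k) D^m / D] with
    [D = d_(k-1)]. *)
Let C := 2 `^ `|p| * (2 * (1 + r)).
Let S k := \sum_(i < k) d i.
Hypothesis sum_le1 : forall k, (C + 1) * S k <= 1.

Definition level_weight k := (1 + C * S k) / d k `^ (m - 1).
Definition level_value k := 2 - S k.
Local Notation a := level_weight.
Local Notation g := level_value.

Let C_gt0 : 0 < C.
Proof. by apply: mulr_gt0; [exact: powR_gt0|move: r_ge1; lra]. Qed.

Let S_ge0 k : 0 <= S k.
Proof. by apply: sumr_ge0 => i _; exact: ltW. Qed.

Let CS k : 0 <= C * S k <= 1.
Proof.
by have := sum_le1 k; have := S_ge0 k; have := mulr_ge0 (ltW C_gt0) (S_ge0 k); lra.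
Qed.

Let S_le1 k : S k <= 1.
Proof. have := sum_le1 k; have /andP[] := CS k; lra. Qed.

Let SS k : S k.+1 = S k + d k.
Proof. by rewrite /S big_ord_recr. Qed.

Let d_le1 k : d k <= 1.
Proof. by have := S_le1 k.+1; have := S_ge0 k; rewrite SS; lra. Qed.

Lemma level_value_bounds k : 1 <= g k <= 2.
Proof. by rewrite /g; have := S_le1 k; have := S_ge0 k; lra. Qed.

(** The flux [1 + C * S k] stays in [1, 2], so the weight has the order of [d_k^(1-m)], from which
    the volume growth is read off. *)
Lemma level_weight_bounds k :
  (d k `^ (m - 1))^-1 <= a k <= 2 * (d k `^ (m - 1))^-1.
Proof.
have dV : 0 < (d k `^ (m - 1))^-1 by rewrite invr_gt0 powR_gt0.
rewrite /a; have := CS k => /andP[h1 h2].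
by rewrite -{1}[_^-1]mul1r !ler_pM2r//; lra.
Qed.

Lemma level_weight_gt0 k : 0 < a k.
Proof.
have /andP[+ _] := level_weight_bounds k; apply: lt_le_trans.
by rewrite invr_gt0 powR_gt0.
Qed.

(** As [g k >= 1], replacing [p] by its absolute value only increases the power, which covers
    negative [p]. *)
Lemma level_value_powR k : g k `^ p <= 2 `^ `|p|.
Proof.
have /andP[g1 g2] := level_value_bounds k.
apply: (@le_trans _ _ (g k `^ `|p|)); first by rewrite ler_powR// ler_norm.
by rewrite ge0_ler_powR ?nnegrE//; move: m_gt1 q_gem; lra.
Qed.

Context {N : nat}.
Hypothesis N_gt1 : (1 < N)%N.
Variable o : TN N.

Lemma radial_supersolution x :
  mlap (@tadj N) (radw o a) m (fun y => g (lvl o y)) x +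
  g (lvl o x) `^ p * gradn (@tadj N) (radw o a) (fun y => g (lvl o y)) x `^ q <= 0.
Proof.
rewrite (mlap_radw N_gt1) (gradn_radw N_gt1 _ level_weight_gt0).
(* At the root [D] reads [d 0] and [I] is 0. *)
set k := lvl o x; set D := d k.-1; set I := inflow a k.
have D0 : 0 < D := d_gt0 _.
have I0 : 0 <= I by rewrite /I /inflow; case: (k) => // j; exact/ltW/level_weight_gt0.
have a0 := level_weight_gt0 k.
have pm j : d j `^ (m - 1) = d j `^ (m - 2) * d j.
  by rewrite -powRDr1//; congr (_ `^ _); lra.
have gk j : g j.+1 - g j = - d j by rewrite /g SS; lra.
have hup : a k * (`|g k.+1 - g k| `^ (m - 2) * (g k.+1 - g k)) = - (1 + C * S k).
  rewrite gk normrN gtr0_norm// mulrN -pm /a mulrN mulfVK//.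
  by rewrite lt0r_neq0 ?powR_gt0.
rewrite hup.
(* Away from the root this is the flux increment [C * d_(k-1)], with equality. At the root the whole
   outgoing flux 1 is available, and [C * d 0 <= 1]. *)
have hdown : I * (`|g k.-1 - g k| `^ (m - 2) * (g k.-1 - g k)) - (1 + C * S k) <= - (C * D).
  rewrite /I /D; case: (k) => [|j] /=.
    rewrite mul0r sub0r lerN2 /S big_ord0 mulr0 addr0.
    by have /andP[_] := CS 1; rewrite /S big_ord1.
  rewrite -[g j - g j.+1]opprB gk opprK gtr0_norm// -pm /a mulfVK ?lt0r_neq0 ?powR_gt0//.
  by rewrite SS; lra.
set G := Num.sqrt _.
(* [G^2] is half a weighted mean of squared increments, each at most [D^2] because [d] is
   nonincreasing. *)
have GD : G <= D.
  rewrite /G -[leRHS](ger0_norm (ltW D0)) -sqrtr_sqr.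
  apply: ler_wsqrtr; rewrite ler_pdivrMr; last lra.
  have down : I * (g k.-1 - g k) ^+ 2 <= I * D ^+ 2.
    rewrite /I /D; case: (k) => [|j] /=; first by rewrite !mul0r.
    by rewrite -[g j - g j.+1]opprB gk opprK.
  have dD : d k <= D by rewrite /D; case: (k) => [|j] /=.
  have up : a k * (g k.+1 - g k) ^+ 2 <= a k * D ^+ 2.
    by rewrite ler_pM2l// gk sqrrN lerXn2r// nnegrE ltW.
  have := mulr_ge0 I0 (sqr_ge0 D); have := mulr_ge0 (ltW a0) (sqr_ge0 D).
  by rewrite mulrCA mulrDr; lra.
have T0 : 0 < I + a k by lra.
(* The inner weight contributes at most 2 after multiplication by [D^(m-1)]; the outer one at most
   [2 r], because [d_doubling] compares [D] with [d k]. *)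
have TD : (I + a k) * D `^ m <= 2 * (1 + r) * D.
  have Dm : D `^ m = D `^ (m - 1) * D.
    by rewrite -powRDr1//; congr (_ `^ _); lra.
  rewrite Dm mulrA ler_pM2r//.
  have Dp : 0 < D `^ (m - 1) by rewrite powR_gt0.
  have hI : I * D `^ (m - 1) <= 2.
    rewrite /I /D; case: (k) => [|j] /=; first by rewrite mul0r.
    by rewrite -ler_pdivlMr ?powR_gt0//; have /andP[] := level_weight_bounds j.
  have ha : a k * D `^ (m - 1) <= 2 * r.
    have h : D `^ (m - 1) <= r * d k `^ (m - 1).
      rewrite /D; case: (k) => [|j] /=; last exact: d_doubling.
      by rewrite ler_peMl ?powR_ge0.
    have dp : 0 < d k `^ (m - 1) by rewrite powR_gt0.
    apply: (@le_trans _ _ (a k * (r * d k `^ (m - 1)))).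
      by rewrite ler_pM2l.
    rewrite mulrCA (mulrC 2) ler_pM2l; last exact: lt_le_trans r_ge1.
    by rewrite -ler_pdivlMr//; have /andP[] := level_weight_bounds k.
  by rewrite mulrDl; lra.
have G0 : 0 <= G := sqrtr_ge0 _.
(* The hypothesis [q >= m] enters through [D <= 1], which gives [D^q <= D^m]. *)
have GDm : G `^ q <= D `^ m.
  apply: (@le_trans _ _ (D `^ q)).
    by rewrite ge0_ler_powR ?nnegrE//; move: m_gt1 q_gem; lra.
  by rewrite ger_powR// D0 d_le1.
have gp := level_value_powR k.
rewrite -lerBrDr sub0r ler_pdivrMr// mulNr.
apply: le_trans hdown _; rewrite lerN2 mulrC.
apply: (@le_trans _ _ ((I + a k) * (2 `^ `|p| * D `^ m))).
  by rewrite ler_pM2l// ler_pM ?powR_ge0.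
by rewrite mulrCA /C -mulrA ler_pM2l ?powR_gt0.
Qed.
End Supersolution.

(** * Choice of the constants and conclusion *)

Theorem mainTheorem9 (R : realType) (N : nat) (HN : (2 <= N)%N) (o : TN N)
    (m p q : R) (Hm : 1 < m) (Hq : m <= q) (eps : R) (Heps : 0 < eps) :
  exists mu : TN N -> TN N -> R,
    is_weight (@tadj N) mu /\
    asymp (fun n => Wo (@tadj N) mu o n)
          (fun n => n%:R `^ m * (ln (n%:R : R)) `^ (m - 1 + eps)) /\
    exists u : TN N -> R,
      (forall x, 0 < u x) /\ (exists x y, u x != u y) /\
      (forall x, mlap (@tadj N) mu m u x
                 + u x `^ p * gradn (@tadj N) mu u x `^ q <= 0).
Proof.
have m10 : 0 < m - 1 by rewrite subr_gt0.
(* Chosen so that [(1 + s) (m - 1) = m - 1 + eps], the exponent of the logarithm. *)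
pose s := eps / (m - 1); have s0 : 0 < s by rewrite divr_gt0.
(* The ratio bound of [logseq_doubling], raised to the power [m - 1]. *)
pose r : R := (2 * 2 `^ (1 + s)) `^ (m - 1).
have r1 : 1 <= r.
  have h : 1 <= 2 * 2 `^ (1 + s) :> R.
    rewrite -[leLHS]mul1r ler_pM ?ler1n//.
    by rewrite -[leLHS](powRr0 2) ler_powR ?ler1n//; lra.
  by rewrite -[leLHS](powRr0 (2 * 2 `^ (1 + s))) ler_powR// ltW.
pose C : R := 2 `^ `|p| * (2 * (1 + r)).
have C0 : 0 < C by apply: mulr_gt0; [exact: powR_gt0|lra].
pose E : R := logseq s 0 + s^-1 * logn2 0 `^ (- s).
have E0 : 0 < E.
  by rewrite addr_gt0 ?logseq_gt0// mulr_gt0 ?invr_gt0 ?powR_gt0 ?logn2_gt0.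
(* [E] bounds all partial sums of [logseq s], so this scaling gives [(C + 1) S_k <= 1]. *)
pose c := ((C + 1) * E)^-1.
have c0 : 0 < c by rewrite invr_gt0 mulr_gt0// addr_gt0.
pose d k := c * logseq s k.
have d0 k : 0 < d k by rewrite mulr_gt0 ?logseq_gt0.
have d_dec k : d k.+1 <= d k by rewrite ler_pM2l// logseq_noninc.
have d_dbl k : d k `^ (m - 1) <= r * d k.+1 `^ (m - 1).
  have B0 : 0 <= 2 * 2 `^ (1 + s) :> R by rewrite mulr_ge0 ?powR_ge0.
  have dn j : d j \is Num.nneg by rewrite nnegrE ltW.
  rewrite -powRM ?(ltW (d0 _))//; apply: ge0_ler_powR => //.
  - exact: ltW.
  - by rewrite nnegrE; apply: mulr_ge0 => //; exact: ltW.
  - by rewrite /d mulrCA ler_pM2l// logseq_doubling.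
have d_sum k : (C + 1) * \sum_(i < k) d i <= 1.
  have cE : (C + 1) * c = E^-1.
    by rewrite /c invfM mulrA divff ?mul1r// lt0r_neq0// addr_gt0.
  rewrite -mulr_sumr mulrA cE mulrC ler_pdivrMr// mul1r; exact: sum_logseq_le.
have a0 k : 0 < level_weight m p r d k by exact: level_weight_gt0.
exists (radw o (level_weight m p r d)); split; first exact: radw_weight.
split.
  have [c1 [C1 [c10 [C10 H]]]] :=
    asymp_sum_powR_ln Hm (addr_gt0 m10 Heps : 0 < m - 1 + eps).
  pose K : R := (c `^ (m - 1))^-1; have K0 : 0 < K by rewrite invr_gt0 powR_gt0.
  (* [K] comes from the scaling of [d] by [c], and the factor 2 from the upper bound on the flux. *)
  exists (K * c1), (2 * K * C1); do 2!(split; first by rewrite !mulr_gt0).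
  move=> n /H[lo up]; rewrite Wo_radw//.
  have aE k : (d k `^ (m - 1))^-1 =
      K * (k.+2%:R `^ (m - 1) * logn2 k `^ (m - 1 + eps)).
    rewrite logseq_powR// (_ : (1 + s) * (m - 1) = m - 1 + eps)//.
    by rewrite mulrDl mul1r divfK// lt0r_neq0.
  have ab k := level_weight_bounds m r1 d0 d_sum k.
  split; rewrite -!mulrA.
    apply: (@le_trans _ _ (K * \sum_(k < n.+1)
        (k.+2%:R `^ (m - 1) * logn2 k `^ (m - 1 + eps)))).
      by rewrite ler_pM2l.
    by rewrite mulr_sumr ler_sum// => k _; rewrite -aE; have /andP[] := ab k.
  apply: (@le_trans _ _ (2 * (K * \sum_(k < n.+1)
      (k.+2%:R `^ (m - 1) * logn2 k `^ (m - 1 + eps))))); last by rewrite !ler_pM2l.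
  by rewrite !mulr_sumr ler_sum// => k _; rewrite -aE; have /andP[] := ab k.
exists (fun x => level_value d (lvl o x)); split.
  move=> x; have /andP[+ _] := level_value_bounds r1 d0 d_sum (lvl o x).
  exact: lt_le_trans.
split; last exact: radial_supersolution.
(* The values at the root and at a neighbour are [2] and [2 - d 0]. *)
exists o, (flip (Ordinal (ltnW HN)) o).
rewrite lvl_flip lvl_root_last ?lvl_root// /level_value big_ord0 big_ord1.
by rewrite subr0 gt_eqF// gtrBl.
Qed.
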